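(* Let $\mathfrak{A}$ be a fusion ring/algebra with basis $\{x_1=1,\dots,x_r\}$. The Schur product property holds on the dual of $\mathfrak{A}$ if and only if for every triple $(\pi_s,V_s)_{s=1,2,3}$ of irreducible unital $*$-representations of $\mathfrak{A}$ over $\mathbb{C}$, and all $v_s\in V_s$, $$\sum_{i=1}^r\frac{1}{d(x_i)}\prod_{s=1}^3\left(v_s^*\pi_s(x_i)v_s\right)\ge0.$$
   Context: Here a fusion algebra $\mathfrak{A}$ means a unital $*$-algebra $\mathcal{B}$ over $\mathbb{C}$ with a basis $\{x_1=1,\dots,x_r\}$ such that $x_jx_k=\sum_sN_{j,k}^sx_s$ with $N_{j,k}^s\in\mathbb{R}_{\ge0}$, and there is an involution $*$ of $\{1,\dots,r\}$ with $x_k^*=x_{k^*}$ and $N_{j,k}^1=\delta_{j,k^*}$; a fusion ring is the case of integer coefficients $N_{j,k}^s\in\mathbb{Z}_{\ge0}$ (then $\mathcal{B}$ is its complexification). $\mathcal{B}$ has the faithful tracial state $\tau(x_j)=\delta_{j,1}$ and is a $C^*$-algebra via left multiplication on $L^2(\mathcal{B},\tau)$; $d$ is the linear functional with $d(x_j)$ equal to the operator norm of left multiplication by $x_j$. The convolution on $\mathcal{B}$ is defined as follows: let $\mathcal{A}$ be the commutative $C^*$-algebra with the same linear basis, multiplication $x_j\diamond x_k=\delta_{j,k}d(x_j)^{-1}x_j$ and anti-linear involution $x_j^\#=x_j$, let $\mathfrak{F}:\mathcal{A}\to\mathcal{B}$ be linear with $\mathfrak{F}(x_j)=x_j$, and put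 $x*_{\mathcal{B}}y:=\big(\mathfrak{F}(\mathfrak{F}^{-1}(y^* )\diamond\mathfrak{F}^{-1}(x^* ))\big)^*$. The Schur product property holds on the dual of $\mathfrak{A}$ if $x*_{\mathcal{B}}y\ge0$ for all $x,y\ge0$ in the $C^*$-algebra $\mathcal{B}$. The representation spaces $V_s$ are finite-dimensional Hilbert spaces, and $v^*Tv=\langle Tv,v\rangle$. ''$\ge 0$'' for a complex number means real and non-negative. *)

(* Defs.v *)
From mathcomp Require Import all_boot all_order all_algebra all_field.
From mathcomp Require Import sesquilinear complex.
From mathcomp Require Import classical_sets reals.

Set Implicit Arguments.
Unset Strict Implicit.
Unset Printing Implicit Defensive.

Import Order.TTheory GRing.Theory Num.Theory.
Local Open Scope ring_scope.
Local Open Scope complex_scope.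
Local Open Scope classical_set_scope.

(* The basis x_1, ..., x_r is indexed by 'I_r with r = fus_rank.+1, so that
   the distinguished index 1 is ord0.  A fusion ring is the special case of
   integral structure constants, fus_alg being its complexification. *)
Record fusionAlgebra (R : realType) := FusionAlgebra {
  fus_alg :> falgType R[i];
  fus_star : fus_alg -> fus_alg;
  fus_rank : nat;
  fus_basis : fus_rank.+1.-tuple fus_alg;
  fus_coef : 'I_fus_rank.+1 -> 'I_fus_rank.+1 -> 'I_fus_rank.+1 -> R;
  fus_dual : 'I_fus_rank.+1 -> 'I_fus_rank.+1;
  fus_star_antilinear : forall (c : R[i]) (a b : fus_alg),
    fus_star (c *: a + b) = c^* *: fus_star a + fus_star b;
  fus_starM : forall a b : fus_alg,
    fus_star (a * b) = fus_star b * fus_star a;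
  fus_starK : involutive fus_star;
  fus_basisP : basis_of fullv fus_basis;
  fus_basis1 : tnth fus_basis ord0 = 1;
  fus_coef_ge0 : forall j k s, 0 <= fus_coef j k s;
  fus_mulE : forall j k, tnth fus_basis j * tnth fus_basis k =
    \sum_s (fus_coef j k s)%:C *: tnth fus_basis s;
  fus_dualK : involutive fus_dual;
  fus_starE : forall k, fus_star (tnth fus_basis k) =
    tnth fus_basis (fus_dual k);
  fus_coef1 : forall j k, fus_coef j k ord0 = (j == fus_dual k)%:R
}.

Section Fusion.
Variables (R : realType) (A : fusionAlgebra R).
Local Notation C := R[i].
Local Notation I := 'I_(fus_rank A).+1.

Definition fus_elt (i : I) : A := tnth (fus_basis A) i.

Definition fus_coord (i : I) (a : A) : C := coord (fus_basis A) i a.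

Definition fus_trace (a : A) : C := fus_coord ord0 a.

(* tau (a^* a) is real and non-negative, so taking its real part is harmless. *)
Definition l2norm (a : A) : R :=
  Num.sqrt (complex.Re (fus_trace (fus_star a * a))).

Definition lmul_opnorm (a : A) : R :=
  sup [set l2norm (a * b) | b in [set b : A | l2norm b <= 1]].

Definition fus_dim (a : A) : C :=
  \sum_i fus_coord i a * (lmul_opnorm (fus_elt i))%:C.

Definition fus_ge0 (a : A) : Prop := exists b : A, a = fus_star b * b.

(* The commutative algebra with the same linear basis as A; its elements are
   given by their coordinates in that basis. *)
Definition dual_alg := {ffun I -> C}.

Definition dual_mul (f g : dual_alg) : dual_alg :=
  [ffun i => f i * g i * (fus_dim (fus_elt i))^-1].

Definition fourier (f : dual_alg) : A := \sum_i f i *: fus_elt i.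

Definition fourier_inv (a : A) : dual_alg := [ffun i => fus_coord i a].

Definition convolution (a b : A) : A :=
  fus_star (fourier (dual_mul (fourier_inv (fus_star b))
                              (fourier_inv (fus_star a)))).

Definition schur_product_on_dual : Prop :=
  forall a b : A, fus_ge0 a -> fus_ge0 b -> fus_ge0 (convolution a b).

(* In {dot V for Num.conj} the form is linear in its first argument and
   conjugate-linear in its second one. *)
Record starRep := StarRep {
  rep_space :> vectType C;
  rep_dot : {dot rep_space for @Num.conj C};
  rep_map : A -> 'End(rep_space);
  rep_linear : linear rep_map;
  rep_map1 : rep_map 1 = \1%VF;
  rep_mapM : forall a b : A, rep_map (a * b) = (rep_map a \o rep_map b)%VF;
  rep_star : forall (a : A) (u v : rep_space),
    rep_dot (rep_map a u) v = rep_dot u (rep_map (fus_star a) v)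
}.

Definition rep_irreducible (rho : starRep) : Prop :=
  (fullv : {vspace rho}) <> 0%VS /\
  forall U : {vspace rho},
    (forall a : A, (rep_map rho a @: U <= U)%VS) -> U = 0%VS \/ U = fullv.

(* v^* pi(a) v *)
Definition rep_coef (rho : starRep) (a : A) (v : rho) : C :=
  rep_dot rho (rep_map rho a v) v.

End Fusion.

(* Main.v *)
Require Import Defs.
From HB Require Import structures.
From mathcomp Require Import all_boot all_order all_algebra all_field.
From mathcomp Require Import sesquilinear complex.
From mathcomp Require Import boolp classical_sets reals.

Set Implicit Arguments.
Unset Strict Implicit.
Unset Printing Implicit Defensive.

Import Order.TTheory GRing.Theory Num.Theory.
Local Open Scope ring_scope.
Local Open Scope complex_scope.

(* The linear map x_i |-> x_{i^*} (transpose) is a *-preserving anti-automorphism,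
   hence preserves positivity, and tau ((a * b) c^t), with * the convolution, is the
   sum over i of d(x_i)^-1 tau (a x_i) tau (b x_i) tau (c x_i).  As an element h is
   positive exactly when tau (h c) >= 0 for all positive c, the Schur product property
   says that these sums are nonnegative for all positive a, b, c.  The functionals
   tau (a _) with a >= 0 are exactly the sums of vector functionals of irreducible
   representations: every vector functional of a representation is of the form
   tau (a _) with a >= 0, and conversely tau (b^* b _) is the vector functional of
   b^* in the regular representation, which splits orthogonally into irreducible
   ones. *)

(** * Star, trace and transpose in coordinates *)

Section FusionTheory.
Variables (R : realType) (A : fusionAlgebra R).
Local Notation C := R[i].
Local Notation I := 'I_(fus_rank A).+1.
Local Notation "x ^*" := (Num.conj x) : complex_scope.
Implicit Types (a b h y : A) (i j k : I) (c : C).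

(* The axiom restated with Num.conj in place of the convertible conjc, for which
   the lemmas on conjugation do not rewrite. *)
Lemma star_linear c a b : fus_star (c *: a + b) = c^* *: fus_star a + fus_star b.
Proof. exact: fus_star_antilinear. Qed.

Lemma star0 : fus_star 0 = 0 :> A.
Proof.
have := star_linear 1 0 0; rewrite scale1r addr0 rmorph1 scale1r => /eqP.
by rewrite -subr_eq0 opprD addNKr oppr_eq0 => /eqP.
Qed.

Lemma starZ c a : fus_star (c *: a) = c^* *: fus_star a.
Proof. by have := star_linear c a 0; rewrite star0 !addr0. Qed.

Lemma starD a b : fus_star (a + b) = fus_star a + fus_star b.
Proof. by have := star_linear 1 a b; rewrite rmorph1 !scale1r. Qed.

Lemma starN a : fus_star (- a) = - fus_star a.
Proof. by rewrite -scaleN1r starZ rmorphN rmorph1 scaleN1r. Qed.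

Lemma star1 : fus_star 1 = 1 :> A.
Proof. by have := fus_starM (fus_star 1) (1 : A); rewrite mulr1 fus_starK mulr1. Qed.

Lemma star_sum (J : Type) (r : seq J) (P : pred J) (F : J -> A) :
  fus_star (\sum_(i <- r | P i) F i) = \sum_(i <- r | P i) fus_star (F i).
Proof. exact: (big_morph _ starD star0). Qed.

Lemma star_elt i : fus_star (fus_elt i) = fus_elt (fus_dual i) :> A.
Proof. exact: fus_starE. Qed.

Lemma coord_sum_elt (F : I -> C) i :
  fus_coord i (\sum_j F j *: fus_elt j : A) = F i.
Proof.
rewrite -[RHS](coord_sum_free F i (basis_free (fus_basisP A))).
by congr fus_coord; apply: eq_bigr => j _; rewrite /fus_elt (tnth_nth 0).
Qed.

Lemma coordK a : \sum_i fus_coord i a *: fus_elt i = a.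
Proof.
rewrite [RHS](coord_basis (fus_basisP A) (memvf a)).
by apply: eq_bigr => j _; rewrite /fus_elt (tnth_nth 0).
Qed.

Lemma coordD i a b : fus_coord i (a + b) = fus_coord i a + fus_coord i b.
Proof. exact: linearD. Qed.

Lemma coordZ i c a : fus_coord i (c *: a) = c * fus_coord i a.
Proof. exact: linearZ. Qed.

Lemma coord_inj a b : (forall i, fus_coord i a = fus_coord i b) -> a = b.
Proof. by move=> ab; rewrite -[a]coordK -[b]coordK; apply: eq_bigr => i _; rewrite ab. Qed.

Lemma coord_elt i j : fus_coord i (fus_elt j : A) = (i == j)%:R.
Proof.
rewrite -(coord_sum_elt (fun k => (k == j)%:R)); congr fus_coord.
rewrite (bigD1 j) //= eqxx scale1r big1 ?addr0 // => k /negPf->.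
by rewrite scale0r.
Qed.

Lemma coord_star i a : fus_coord i (fus_star a) = (fus_coord (fus_dual i) a)^*.
Proof.
rewrite -{1}[a]coordK star_sum.
rewrite (reindex_inj (inv_inj (@fus_dualK R A))) /=.
under eq_bigr => j _ do rewrite starZ star_elt fus_dualK.
exact: coord_sum_elt.
Qed.

Lemma dual0 : fus_dual ord0 = ord0 :> I.
Proof.
have: fus_star (fus_elt ord0) = fus_elt ord0 :> A.
  by rewrite /fus_elt fus_basis1 star1.
rewrite star_elt => /(congr1 (@fus_coord R A ord0)); rewrite !coord_elt eqxx.
by case: eqP => // _ /eqP; rewrite eq_sym oner_eq0.
Qed.

Lemma traceD a b : fus_trace (a + b) = fus_trace a + fus_trace b.
Proof. exact: linearD. Qed.

Lemma traceZ c a : fus_trace (c *: a) = c * fus_trace a.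
Proof. exact: linearZ. Qed.

Lemma traceN a : fus_trace (- a) = - fus_trace a.
Proof. exact: linearN. Qed.

Lemma trace_sum (J : Type) (r : seq J) (P : pred J) (F : J -> A) :
  fus_trace (\sum_(i <- r | P i) F i) = \sum_(i <- r | P i) fus_trace (F i).
Proof. exact: linear_sum. Qed.

Lemma trace_star a : fus_trace (fus_star a) = (fus_trace a)^*.
Proof. by rewrite /fus_trace coord_star dual0. Qed.

(** By [fus_coef1] the trace of $x_jx_k$ is 1 if $j=k^*$ and 0 otherwise, so only the terms with
    $k=j^*$ contribute. *)
Lemma trace_mul a b :
  fus_trace (a * b) = \sum_i fus_coord i a * fus_coord (fus_dual i) b.
Proof.
rewrite -{1}[a]coordK mulr_suml trace_sum; apply: eq_bigr => i _.
rewrite -{1}[b]coordK mulr_sumr trace_sum (bigD1 (fus_dual i)) //= big1 ?addr0.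
  rewrite -scalerAl -scalerAr !traceZ /fus_elt fus_mulE /fus_trace coord_sum_elt.
  by rewrite fus_coef1 fus_dualK eqxx mulr1.
move=> j ij; rewrite -scalerAl -scalerAr !traceZ /fus_elt fus_mulE /fus_trace.
rewrite coord_sum_elt fus_coef1; case: (i =P fus_dual j) ij => [->|_ _]; last by rewrite !mulr0.
by rewrite fus_dualK eqxx.
Qed.

Lemma traceC a b : fus_trace (a * b) = fus_trace (b * a).
Proof.
rewrite !trace_mul (reindex_inj (inv_inj (@fus_dualK R A))) /=.
by apply: eq_bigr => i _; rewrite fus_dualK mulrC.
Qed.

(** The basis is orthonormal for the trace form; positivity and faithfulness of the trace are read
    off from this sum of squares. *)
Lemma trace_starM a : fus_trace (fus_star a * a) = \sum_i `|fus_coord i a| ^+ 2.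
Proof.
rewrite traceC trace_mul; apply: eq_bigr => i _.
by rewrite coord_star fus_dualK normCK.
Qed.

Lemma trace_starM_ge0 a : 0 <= fus_trace (fus_star a * a).
Proof. by rewrite trace_starM sumr_ge0 // => i _; rewrite exprn_ge0. Qed.

Lemma trace_starM_eq0 a : fus_trace (fus_star a * a) = 0 -> a = 0.
Proof.
rewrite trace_starM => /eqP; rewrite psumr_eq0 => [/allP a0|i _]; last exact: exprn_ge0.
apply: coord_inj => i; rewrite [RHS]linear0; apply/eqP.
by have := a0 i (mem_index_enum _); rewrite /= sqrf_eq0 normr_eq0.
Qed.

Lemma trace_starM_gt0 a : a != 0 -> 0 < fus_trace (fus_star a * a).
Proof.
move=> a0; rewrite lt_neqAle trace_starM_ge0 andbT eq_sym.
by apply: contra a0 => /eqP/trace_starM_eq0 ->.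
Qed.

Definition transpose a : A := \sum_i fus_coord (fus_dual i) a *: fus_elt i.

Lemma coord_transpose i a : fus_coord i (transpose a) = fus_coord (fus_dual i) a.
Proof. exact: coord_sum_elt. Qed.

Lemma transposeK : involutive transpose.
Proof. by move=> a; apply: coord_inj => i; rewrite !coord_transpose fus_dualK. Qed.

Lemma transpose_star a : transpose (fus_star a) = fus_star (transpose a).
Proof.
by apply: coord_inj => i; rewrite coord_transpose !coord_star coord_transpose.
Qed.

Lemma transpose_linear : linear transpose.
Proof.
by move=> c a b; apply: coord_inj => i; rewrite coordD coordZ !coord_transpose coordD coordZ.
Qed.

HB.instance Definition _ := GRing.isLinear.Build C A A *:%R transpose transpose_linear.

Lemma transpose_elt i : transpose (fus_elt i) = fus_elt (fus_dual i).
Proof.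
apply: coord_inj => j; rewrite coord_transpose !coord_elt.
by rewrite (inv_eq (@fus_dualK R A)).
Qed.

(* On products of basis elements the transpose agrees with the star, the
   structure constants being real. *)
Lemma transposeM a b : transpose (a * b) = transpose b * transpose a.
Proof.
rewrite -[a]coordK -[b]coordK mulr_suml !linear_sum mulr_sumr.
apply: eq_bigr => i _; rewrite mulr_sumr linear_sum mulr_suml; apply: eq_bigr => j _.
rewrite -scalerAl -scalerAr !linearZ /= -scalerAl -scalerAr scalerA [in RHS]scalerA.
rewrite [X in _ = X *: _]mulrC; congr (_ *: _).
rewrite !transpose_elt -!star_elt -fus_starM; apply: coord_inj => k.
rewrite coord_transpose coord_star /fus_elt fus_mulE coord_sum_elt.
by rewrite conj_Creal ?complex_real ?eqxx.
Qed.

Lemma fus_ge0_starM a : fus_ge0 (fus_star a * a).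
Proof. by exists a. Qed.

(** Transposition reverses products, so it takes $b^*b$ to $cc^*$ with $c=b^t$. *)
Lemma fus_ge0_transpose a : fus_ge0 a -> fus_ge0 (transpose a).
Proof.
by case=> b ->; exists (fus_star (transpose b)); rewrite transposeM transpose_star fus_starK.
Qed.

(* For k = h - h^* the functional y^* y |-> tau (k y^* y) vanishes; expanding it
   at y = 1 + 'i k leaves only the cross term, a multiple of tau (k^* k). *)
Lemma trace_pos_self_adjoint h :
  (forall y, 0 <= fus_trace (h * (fus_star y * y))) -> fus_star h = h.
Proof.
move=> hP; pose k := h - fus_star h.
have starK : fus_star k = - k by rewrite /k starD starN fus_starK opprB.
have k0 y : fus_trace (k * (fus_star y * y)) = 0.
  rewrite mulrBl traceD traceN.
  have -> : fus_star h * (fus_star y * y) = fus_star (fus_star y * y * h).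
    by rewrite !fus_starM fus_starK.
  by rewrite trace_star [X in _ - X^*]traceC conj_Creal ?subrr // ger0_real.
suff: k = 0 by rewrite /k; move=> /eqP; rewrite subr_eq0 => /eqP.
move: k starK k0 => {hP} k starK k0.
have /eqP := k0 (1 + 'i *: k).
(* As $k$ is skew-adjoint, $1+ik$ is self-adjoint with square $1+2ik+k^*k$. The terms $1$ and $k^*k$
   are kept in the form $y^*y$, so that [k0] removes them as well. *)
have -> : fus_star (1 + 'i *: k) * (1 + 'i *: k) = fus_star 1 * 1 + (fus_star k * k + ('i *+ 2) *: k).
  have -> : fus_star (1 + 'i *: k) = 1 + 'i *: k.
    by rewrite starD starZ star1 starK conjCi scaleNr scalerN opprK.
  have kk : fus_star k * k = ('i *: k) * ('i *: k).
    by rewrite starK -scalerAl -scalerAr scalerA -expr2 sqrCi scaleN1r mulNr.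
  rewrite kk star1 mulr1 mulrDl mul1r mulrDr mulr1 -scalerMnl mulr2n -!addrA.
  by congr (1 + _); rewrite [RHS]addrC -addrA.
rewrite !mulrDr !traceD !k0 !add0r -scalerAr traceZ
  mulf_eq0 mulrn_eq0 (negPf (neq0Ci _)) /=.
by rewrite -[X in X * k]opprK -starK mulNr traceN oppr_eq0 => /eqP/trace_starM_eq0.
Qed.

End FusionTheory.

(** * Polynomial calculus and self-duality of the positive cone *)

Lemma interpolation (F : fieldType) (s : seq F) (f : F -> F) :
  uniq s -> exists p : {poly F}, {in s, forall z, p.[z] = f z}.
Proof.
elim: s => [|z s IH] /=; first by exists 0.
case/andP=> zs /IH[p pP]; pose q := \prod_(y <- s) ('X - y%:P).
have qz : q.[z] != 0 by rewrite -/(root q z) root_prod_XsubC.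
(* Newton's correction: [q] vanishes at the earlier points but not at the new point [z]. *)
exists (p + ((f z - p.[z]) / q.[z]) *: q) => y; rewrite inE hornerD hornerZ.
have [-> _|_ /= ys] := eqVneq y z; first by rewrite divfK // addrC subrK.
have /rootP-> : root q y by rewrite root_prod_XsubC.
by rewrite mulr0 addr0 pP.
Qed.

Section Positivity.
Variables (R : realType) (A : fusionAlgebra R).
Local Notation C := R[i].
Local Notation I := 'I_(fus_rank A).+1.
Local Notation "x ^*" := (Num.conj x) : complex_scope.
Implicit Types (a b h y : A) (i j k : I) (c z : C) (s : seq C) (p q : {poly C}).
Local Notation prodX s := (\prod_(z <- s) ('X - z%:P)).

(** The powers of [h] up to the dimension are linearly dependent, which gives a nonzero annihilating
    polynomial; it splits over [R[i]], and its leading coefficient can be divided out. *)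
Lemma annihilating_roots h : exists s, horner_alg h (prodX s) = 0.
Proof.
pose X := [tuple h ^+ i | i < (\dim {:A}).+1].
have /freeP nfree : ~~ free X.
  apply/eqP; rewrite size_tuple => dX.
  by have := dimvS (subvf <<X>>%VS); rewrite dX ltnn.
suff [p p0 hp]: exists2 p : {poly C}, p != 0 & horner_alg h p = 0.
  have [s ps] := closed_field_poly_normal p; exists s; apply/eqP.
  move: hp; rewrite {1}ps linearZ /= mulr_algl => /eqP; rewrite scaler_eq0 lead_coef_eq0.
  by rewrite (negPf p0).
apply: contrapT => nop; apply: nfree => k k0 i.
apply: contrapT => /eqP ki; apply: nop; exists (\poly_(j < (\dim {:A}).+1) k (inord j)).
  apply: contra ki => /eqP/polyP/(_ i); rewrite coef_poly ltn_ord inord_val coef0.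
  by move=> ->.
rewrite poly_def linear_sum -[RHS]k0; apply: eq_bigr => j _ /=.
by rewrite linearZ rmorphXn /= mulr_algl horner_algX inord_val (nth_mktuple _ _ j).
Qed.

Lemma horner_alg_cons h z s :
  horner_alg h (prodX (z :: s)) = (h - z%:A) * horner_alg h (prodX s).
Proof. by rewrite big_cons rmorphM rmorphB /= horner_algX horner_algC. Qed.

(* An annihilating product of minimal length works: for a root z with cofactor q,
   h q = z q gives z >= 0, and a double root would make q^* q vanish. *)
Lemma trace_pos_roots h :
  (forall y, 0 <= fus_trace (h * (fus_star y * y))) ->
  exists s, [/\ uniq s, {in s, forall z, 0 <= z} & horner_alg h (prodX s) = 0].
Proof.
move=> hP; have hh := trace_pos_self_adjoint hP.
have [s] := annihilating_roots h.
have [n] := ubnP (size s); elim: n s => // n IH s sn s0.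
have [/hasP[z zs /eqP z0]|/hasPn zP] := boolP (has (fun z => horner_alg h (prodX (rem z s)) == 0) s).
  by apply: IH z0; move: sn; rewrite (perm_size (perm_to_rem zs)).
have hz z : z \in s -> (h - z%:A) * horner_alg h (prodX (rem z s)) = 0.
  by move=> zs; rewrite -horner_alg_cons -s0 (perm_big _ (perm_to_rem zs)).
have s_ge0 : {in s, forall z, 0 <= z}.
  move=> z zs; have := hz z zs; set q := horner_alg _ _ => hq.
  have q0 : fus_star q != 0.
    by apply: contra (zP z zs) => /eqP q0; rewrite -/q -[q]fus_starK q0 star0.
  have := hP (fus_star q); rewrite mulrA fus_starK.
  have -> : h * q = z *: q.
    by apply/eqP; rewrite -subr_eq0 -{2}[q]mul1r scalerAl -mulrBl hq.
  rewrite -scalerAl traceZ -{1}[q]fus_starK.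
  by rewrite pmulr_lge0 // trace_starM_gt0.
exists s; split=> //; apply: count_mem_uniq => z.
have [zs|/count_memPn-> //] := boolP (z \in s).
rewrite (permP (perm_to_rem zs)) /= eqxx; congr (1 + _)%N; apply/count_memPn.
apply/negP => zrs; have /eqP[] := zP z zs.
have hq := hz z zs; apply: trace_starM_eq0.
(* A second occurrence of [z] makes the cofactor $q=(h-z)q'$, whence $q^*q=q'^*(h-z)q=0$; here $h-z$
   is self-adjoint because $z\ge0$ is real. *)
rewrite {1}(perm_big _ (perm_to_rem zrs)) horner_alg_cons fus_starM.
have -> : fus_star (h - z%:A) = h - z%:A.
  by rewrite starD starN hh starZ star1 conj_Creal // ger0_real // s_ge0.
by rewrite -mulrA hq mulr0 [LHS]linear0.
Qed.

Lemma star_horner_alg h p : fus_star h = h ->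
  fus_star (horner_alg h p) = horner_alg h (map_poly Num.conj p).
Proof.
move=> hh; elim/poly_ind: p => [|p c IH]; first by rewrite !rmorph0 star0.
rewrite !(rmorphD, rmorphM) /= !map_polyX !map_polyC !horner_algX !horner_algC.
rewrite starD starZ star1 fus_starM IH hh -{1}[h]horner_algX -rmorphM mulrC.
by rewrite rmorphM /= horner_algX.
Qed.

(* The square root of h is p(h), with p interpolating the square root on the roots
   of an annihilating polynomial of h. *)
Lemma trace_pos_ge0 h :
  (forall y, 0 <= fus_trace (h * (fus_star y * y))) -> fus_ge0 h.
Proof.
move=> hP; have hh := trace_pos_self_adjoint hP.
have [s [us s_ge0 hs]] := trace_pos_roots hP.
have [p pP] := interpolation (fun z : C => sqrtC z) us.
(* As the points of [s] are distinct, a polynomial vanishing at all of them is a multiple of the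
   annihilating product. *)
have eqs q r : {in s, forall z, q.[z] = r.[z]} -> horner_alg h q = horner_alg h r.
  move=> qr; apply/eqP; rewrite -subr_eq0 -rmorphB.
  have /dvdpP[t ->] : prodX s %| q - r.
    apply: uniq_roots_dvdp; last by rewrite uniq_rootsE.
    by apply/allP => z zs; rewrite /root hornerD hornerN qr ?subrr.
  by rewrite rmorphM [X in _ * X]hs mulr0.
exists (horner_alg h p); rewrite star_horner_alg // -rmorphM -{1}[h]horner_algX.
apply: eqs => z zs; rewrite hornerX hornerM pP //.
(* At the real point [z] the conjugated polynomial takes the conjugate of $p(z)=\sqrt z$, which is
   again $\sqrt z$. *)
rewrite -{2}[z]conj_Creal ?ger0_real ?s_ge0 // horner_map pP //.
rewrite -[LHS]sqrtCK expr2; congr (_ * _); symmetry; apply: conj_Creal.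
by rewrite ger0_real ?sqrtC_ge0 ?s_ge0.
Qed.

End Positivity.

(** * Restriction of a representation to an invariant subspace *)

Section SubRep.
Variables (R : realType) (A : fusionAlgebra R) (rho : starRep A).
Local Notation C := R[i].
Variable U : {vspace rho}.
Hypothesis stableU : forall a : A, (rep_map rho a @: U <= U)%VS.

Definition sub_dot (u v : subvs_of U) : C := rep_dot rho (vsval u) (vsval v).

Lemma sub_dot_bilinear : bilinear_for *%R (Num.conj \; *%R) sub_dot.
Proof.
split=> u a v w; first exact: linearPl.
exact: linearPr.
Qed.

HB.instance Definition _ := bilinear_isBilinear.Build C (subvs_of U) (subvs_of U)
  C *%R (Num.conj \; *%R) sub_dot sub_dot_bilinear.

Lemma sub_dot_hermitian u v : sub_dot u v = (-1) ^+ false * Num.conj (sub_dot v u).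
Proof. exact: hermC. Qed.

HB.instance Definition _ := isHermitianSesquilinear.Build C (subvs_of U) false
  Num.conj sub_dot sub_dot_hermitian.

Lemma sub_dot_gt0 u : u != 0 -> 0 < sub_dot u u.
Proof. by move=> u0; rewrite dnorm_gt0. Qed.

HB.instance Definition _ := isDotProduct.Build C (subvs_of U) sub_dot sub_dot_gt0.

(** The projection only serves to land in the type of vectors of [U]: by stability the image already
    lies in [U]. *)
Definition sub_map a : 'End(subvs_of U) :=
  linfun (vsproj U \o rep_map rho a \o vsval).

Lemma sub_mapE a u : vsval (sub_map a u) = rep_map rho a (vsval u).
Proof.
rewrite lfunE /= vsprojK //; apply: (subvP (stableU a)).
exact/memv_img/subvsP.
Qed.

Lemma sub_map_linear : linear sub_map.
Proof.
move=> c a b; apply/lfunP => u; apply: subvs_inj.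
rewrite !(add_lfunE, scale_lfunE) linearP sub_mapE rep_linear.
by rewrite add_lfunE scale_lfunE /= !sub_mapE.
Qed.

Lemma sub_map1 : sub_map 1 = \1%VF.
Proof. by apply/lfunP => u; apply: subvs_inj; rewrite sub_mapE rep_map1 !id_lfunE. Qed.

Lemma sub_mapM a b : sub_map (a * b) = (sub_map a \o sub_map b)%VF.
Proof.
apply/lfunP => u; apply: subvs_inj.
by rewrite comp_lfunE !sub_mapE rep_mapM comp_lfunE.
Qed.

Lemma sub_map_star a u v : sub_dot (sub_map a u) v = sub_dot u (sub_map (fus_star a) v).
Proof. by rewrite /sub_dot !sub_mapE rep_star. Qed.

Definition sub_rep : starRep A :=
  StarRep (rep_dot := sub_dot) sub_map_linear sub_map1 sub_mapM sub_map_star.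

Lemma rep_coef_sub a (u : sub_rep) : rep_coef a u = rep_coef (rho := rho) a (vsval u).
Proof. by rewrite /rep_coef /= /sub_dot sub_mapE. Qed.

End SubRep.

(** * Splitting vector functionals into irreducible ones *)

Section IrreducibleCone.
Variables (R : realType) (A : fusionAlgebra R).
Local Notation C := R[i].

Lemma orthov_stable (rho : starRep A) (U : {vspace rho}) :
  (forall a : A, (rep_map rho a @: U <= U)%VS) ->
  forall a : A, (rep_map rho a @: orthov (rep_dot rho) U <= orthov (rep_dot rho) U)%VS.
Proof.
move=> stU a; apply/subvP => _ /memv_imgP[w /mem_orthovP wU ->].
apply/mem_orthovP => u uU; apply: etrans (rep_star a w u) _; apply: wU.
exact/(subvP (stU _))/memv_img.
Qed.

Lemma dim_lt_fullv (V : vectType C) (U : {vspace V}) :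
  U <> fullv -> (\dim U < \dim {:V})%N.
Proof.
move=> Uf; rewrite ltn_neqAle dimvS ?subvf // andbT; apply/negP => /eqP dU.
by apply: Uf; apply/eqP; rewrite eqEdim subvf dU leqnn.
Qed.

Lemma rep_coef_orthoD (rho : starRep A) (U : {vspace rho}) (u w : rho) :
  (forall a : A, (rep_map rho a @: U <= U)%VS) ->
  u \in U -> w \in orthov (rep_dot rho) U ->
  forall a : A, rep_coef a (u + w) = rep_coef a u + rep_coef a w.
Proof.
move=> stU uU wU a.
have wa (x : rho) : x \in U -> rep_dot rho w x = 0 by move: wU => /mem_orthovP; apply.
have aU b : rep_map rho b u \in U by exact/(subvP (stU _))/memv_img.
have auw : rep_dot rho (rep_map rho a u) w = 0.
  by rewrite hermC /= wa ?conjC0 ?mulr0.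
have awu : rep_dot rho (rep_map rho a w) u = 0 by rewrite rep_star wa.
rewrite /rep_coef [rep_map _ _ _]linearD linearDl !linearDr /= auw awu.
by rewrite add0r addr0.
Qed.

(** Induction on the dimension: a proper nonzero invariant subspace and its orthogonal complement
    are both smaller, and the functional of [v] is the sum of those of its two components. The
    closure of [Q] under zero covers the zero space. *)
Lemma irreducible_cone (Q : (A -> C) -> Prop) :
  Q (fun=> 0) ->
  (forall f g, Q f -> Q g -> Q (fun a => f a + g a)) ->
  (forall (rho : starRep A) (v : rho),
     rep_irreducible rho -> Q (fun a => rep_coef a v)) ->
  forall (rho : starRep A) (v : rho), Q (fun a => rep_coef a v).
Proof.
move=> Q0 QD Qirr rho; have [n] := ubnP (\dim {:rho}).
elim: n rho => // n IH rho dn v.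
have [irr|nirr] := EM (rep_irreducible rho); first exact: Qirr.
have [triv|ntriv] := EM (fullv = 0%VS :> {vspace rho}).
  suff -> : (fun a => rep_coef a v) = (fun=> 0) by [].
  have v0 : v = 0 by apply/eqP; rewrite -memv0 -triv memvf.
  by apply/funext => a; rewrite /rep_coef v0 linear0r.
have [U [stU U0 Uf]] : exists U : {vspace rho},
    [/\ forall a : A, (rep_map rho a @: U <= U)%VS, U <> 0%VS & U <> fullv].
  apply: contrapT => noU; apply: nirr; split=> // U stU.
  apply: contrapT => /not_orP[U0 Uf]; apply: noU.
  by exists U.
have stW := orthov_stable stU; set W := orthov _ U in stW.
(* Otherwise a nonzero vector of [U] would be orthogonal to itself. *)
have Wf : W <> fullv.
  move=> Wf; apply: U0; apply/eqP; rewrite -vpick0.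
  have /mem_orthovP/(_ (vpick U) (memv_pick U))/eqP : vpick U \in W by rewrite Wf memvf.
  by rewrite dnorm_eq0.
have QU (X : {vspace rho}) (stX : forall a : A, (rep_map rho a @: X <= X)%VS) (x : rho) :
    X <> fullv -> x \in X -> Q (fun a => rep_coef a x).
  move=> /dim_lt_fullv dX xX.
  have := IH (sub_rep stX) _ (vsproj X x); rewrite dimvf => /(_ (leq_trans dX dn)).
  by under eq_fun do rewrite rep_coef_sub vsprojK //.
have [u Uu [w [vE _ ow]]] := orthogonal_split (rep_dot rho) (vbasis U) v.
rewrite (span_basis (vbasisP U)) in Uu.
have Ww : w \in W.
  move: ow; rewrite orthogonalE (span_basis (vbasisP U)) => /subvP; apply.
  by rewrite span_seq1 memv_line.
have -> : (fun a => rep_coef a v) = (fun a => rep_coef a u + rep_coef a w).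
  by apply/funext => a; rewrite vE (rep_coef_orthoD stU).
by apply: QD; [apply: (QU U)|apply: (QU W)].
Qed.

End IrreducibleCone.

(** * Positive functionals, the regular representation and the convolution *)

Section States.
Variables (R : realType) (A : fusionAlgebra R).
Local Notation C := R[i].
Local Notation I := 'I_(fus_rank A).+1.
Implicit Types (a b c x y : A).

(** The GNS inner product of the trace, with the star on the second argument to match the convention
    of [rep_dot]. *)
Definition regular_dot a b : C := fus_trace (fus_star b * a).

Lemma regular_dot_bilinear : bilinear_for *%R (Num.conj \; *%R) regular_dot.
Proof.
split=> u z v w; rewrite /regular_dot.
  by rewrite mulrDr -scalerAr traceD traceZ.
by rewrite star_linear mulrDl -scalerAl traceD traceZ.
Qed.

HB.instance Definition _ := bilinear_isBilinear.Build C A A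
  C *%R (Num.conj \; *%R) regular_dot regular_dot_bilinear.

Lemma regular_dot_hermitian a b :
  regular_dot a b = (-1) ^+ false * Num.conj (regular_dot b a).
Proof. by rewrite /regular_dot mul1r -trace_star fus_starM fus_starK. Qed.

HB.instance Definition _ := isHermitianSesquilinear.Build C A false
  Num.conj regular_dot regular_dot_hermitian.

HB.instance Definition _ := isDotProduct.Build C A regular_dot
  (fun a => @trace_starM_gt0 R A a).

Lemma regular_map1 : amull (1 : A) = \1%VF.
Proof. exact: amull1. Qed.

Lemma regular_mapM a b : amull (a * b) = (amull a \o amull b)%VF.
Proof. exact: amullM. Qed.

Lemma regular_star a b c :
  regular_dot (amull a b) c = regular_dot b (amull (fus_star a) c).
Proof. by rewrite /regular_dot !lfunE /= fus_starM fus_starK mulrA. Qed.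

Definition regular_rep : starRep A :=
  StarRep (rep_dot := regular_dot) (@amull_is_linear _ A) regular_map1 regular_mapM
    regular_star.

Lemma rep_coef_regular a b :
  rep_coef (rho := regular_rep) a (fus_star b) = fus_trace (fus_star b * b * a).
Proof.
by rewrite /rep_coef /= /regular_dot lfunE /= fus_starK mulrA traceC mulrA.
Qed.

Lemma rep_coef_sum (rho : starRep A) (v : rho) x :
  rep_coef x v = \sum_i fus_coord i x * rep_coef (fus_elt i) v.
Proof.
have coefL z a b : rep_coef (z *: a + b) v = z * rep_coef a v + rep_coef b v.
  by rewrite /rep_coef rep_linear add_lfunE scale_lfunE linearPl.
have coef0 : rep_coef 0 v = 0.
  by have /eqP := coefL (-1) 0 0; rewrite scaler0 addr0 mulN1r addNr => /eqP.
rewrite -{1}[x]coordK; elim/big_rec2: _ => // i _ y _ <-.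
exact: coefL.
Qed.

Lemma rep_coef_starM_ge0 (rho : starRep A) (v : rho) y :
  0 <= rep_coef (fus_star y * y) v.
Proof.
by rewrite /rep_coef rep_mapM comp_lfunE rep_star fus_starK dnorm_ge0.
Qed.

(** Riesz representation: $\tau(ax_i)$ is the coordinate of $a$ at $i^*$, which dictates $a$; its
    positivity follows from that of the functional on all $y^*y$. *)
Lemma rep_coef_trace (rho : starRep A) (v : rho) :
  exists2 a : A, fus_ge0 a & forall x, rep_coef x v = fus_trace (a * x).
Proof.
pose a : A := \sum_i rep_coef (fus_elt (fus_dual i)) v *: fus_elt i.
have aE x : rep_coef x v = fus_trace (a * x).
  rewrite rep_coef_sum trace_mul (reindex_inj (inv_inj (@fus_dualK R A))) /=.
  by apply: eq_bigr => i _; rewrite coord_sum_elt mulrC.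
exists a => //; apply: trace_pos_ge0 => y; rewrite -aE.
exact: rep_coef_starM_ge0.
Qed.

Lemma fus_ge0_cone (Q : (A -> C) -> Prop) :
  Q (fun=> 0) ->
  (forall f g, Q f -> Q g -> Q (fun a => f a + g a)) ->
  (forall (rho : starRep A) (v : rho),
     rep_irreducible rho -> Q (fun a => rep_coef a v)) ->
  forall a, fus_ge0 a -> Q (fun x => fus_trace (a * x)).
Proof.
move=> Q0 QD Qirr _ [b ->]; under eq_fun do rewrite -rep_coef_regular.
exact: irreducible_cone.
Qed.

(** Cyclicity turns $\tau(c^*cy^*y)$ into $\tau(z^*z)$ with $z=yc^*$. *)
Lemma trace_ge0 a b : fus_ge0 a -> fus_ge0 b -> 0 <= fus_trace (a * b).
Proof.
move=> [c ->] [y ->]; rewrite -mulrA traceC.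
have -> : c * (fus_star y * y) * fus_star c = fus_star (y * fus_star c) * (y * fus_star c).
  by rewrite fus_starM fus_starK !mulrA.
exact: trace_starM_ge0.
Qed.

Lemma fus_dim_eltE (i : I) : fus_dim (fus_elt i : A) = (lmul_opnorm (fus_elt i : A))%:C.
Proof.
rewrite /fus_dim (bigD1 i) //= coord_elt eqxx mul1r big1 ?addr0 // => j /negPf ji.
by rewrite coord_elt ji mul0r.
Qed.

(** Each star conjugates coordinates and moves them to the dual index. The inner and outer stars
    cancel on [a] and [b], while $d$, being real, only keeps the outer dual index. *)
Lemma coord_convolution (i : I) a b :
  fus_coord i (convolution a b) =
  fus_coord i a * fus_coord i b * (fus_dim (fus_elt (fus_dual i) : A))^-1.
Proof.
rewrite coord_star coord_sum_elt !ffunE !coord_star fus_dualK !rmorphM /= !conjCK.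
rewrite mulrC [X in _ = X * _]mulrC mulrC; congr (_ * _).
rewrite fmorphV; congr (_^-1).
by rewrite fus_dim_eltE; exact: conjc_real.
Qed.

Lemma trace_mul_elt a i : fus_trace (a * fus_elt i) = fus_coord (fus_dual i) a.
Proof.
rewrite trace_mul (bigD1 (fus_dual i)) //= fus_dualK coord_elt eqxx mulr1.
rewrite big1 ?addr0 // => j ji; rewrite coord_elt.
by rewrite (inv_eq (@fus_dualK R A)) (negPf ji) mulr0.
Qed.

(** The transpose cancels the dual index of [trace_mul], and reindexing by the involution brings $d$
    back to $x_i$. *)
Lemma trace_convolution a b c :
  fus_trace (convolution a b * transpose c) =
  \sum_i (fus_dim (fus_elt i : A))^-1 *
    (fus_trace (a * fus_elt i) * fus_trace (b * fus_elt i) * fus_trace (c * fus_elt i)).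
Proof.
rewrite trace_mul (reindex_inj (inv_inj (@fus_dualK R A))) /=.
apply: eq_bigr => i _; rewrite coord_convolution coord_transpose !fus_dualK.
by rewrite !trace_mul_elt mulrA [X in _ = X * _]mulrC.
Qed.

End States.

Theorem proposition8p3 (R : realType) (A : fusionAlgebra R) :
  schur_product_on_dual A <->
  (forall rho : 'I_3 -> starRep A,
     (forall s, rep_irreducible (rho s)) ->
     forall v : (forall s, rho s),
       0 <= \sum_(i < (fus_rank A).+1) (fus_dim (fus_elt i))^-1 *
              \prod_(s < 3) rep_coef (fus_elt i) (v s)).
Proof.
split=> [schur rho irr v|pos a b a0 b0].
  pose s0 : 'I_3 := ord0; pose s1 := lift ord0 ord0 : 'I_3.
  pose s2 := lift ord0 (lift ord0 ord0) : 'I_3.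
  have [a a0 aE] := rep_coef_trace (v s0).
  have [b b0 bE] := rep_coef_trace (v s1).
  have [c c0 cE] := rep_coef_trace (v s2).
  rewrite (_ : \sum_i _ = fus_trace (convolution a b * transpose c)).
    by apply: trace_ge0; [exact: schur|exact: fus_ge0_transpose].
  rewrite trace_convolution; apply: eq_bigr => i _; congr (_ * _).
  by rewrite !big_ord_recl big_ord0 mulr1 -aE -bE -cE mulrA.
(* By self-duality it suffices to pair with $y^*y$, written as a double transpose so that
   [trace_convolution] applies. *)
apply: trace_pos_ge0 => y; rewrite -[_ * y]transposeK trace_convolution.
have := fus_ge0_transpose (fus_ge0_starM y); move: (transpose _) => c c0.
(* This sum is additive in each slot, so [fus_ge0_cone] reduces the three functionals, one after the
   other, to irreducible vector functionals. *)
pose T (f g h : A -> R[i]) : R[i] :=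
  \sum_i (fus_dim (fus_elt i : A))^-1 * (f (fus_elt i) * g (fus_elt i) * h (fus_elt i)).
have T0 f g : [/\ T (fun=> 0) f g = 0, T f (fun=> 0) g = 0 & T f g (fun=> 0) = 0].
  by split; apply: big1 => i _; rewrite ?mulr0 ?mul0r ?mulr0.
have TD f f' g h : [/\ T (fun x => f x + f' x) g h = T f g h + T f' g h,
    T g (fun x => f x + f' x) h = T g f h + T g f' h &
    T g h (fun x => f x + f' x) = T g h f + T g h f'].
  by split; rewrite -big_split; apply: eq_bigr => i _; rewrite /= ?mulrDr ?mulrDl ?mulrDr.
set fa := fun x => fus_trace (a * x); set fb := fun x => fus_trace (b * x).
set fc := fun x => fus_trace (c * x); rewrite -/(T fa fb fc).
apply: (fus_ge0_cone (Q := fun f => 0 <= T f fb fc)) a0 => [|f g f0 g0|rho1 v1 irr1].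
- by have [-> _ _] := T0 fb fc.
- by have [-> _ _] := TD f g fb fc; rewrite addr_ge0.
set f1 := fun x => rep_coef x v1.
apply: (fus_ge0_cone (Q := fun f => 0 <= T f1 f fc)) b0 => [|f g f0 g0|rho2 v2 irr2].
- by have [_ -> _] := T0 f1 fc.
- by have [_ -> _] := TD f g f1 fc; rewrite addr_ge0.
set f2 := fun x => rep_coef x v2.
apply: (fus_ge0_cone (Q := fun f => 0 <= T f1 f2 f)) c0 => [|f g f0 g0|rho3 v3 irr3].
- by have [_ _ ->] := T0 f1 f2.
- by have [_ _ ->] := TD f g f1 f2; rewrite addr_ge0.
(* Indexing by naturals lets [match] build the dependent family of vectors; from ['I_3] the default
   branch is reached only at 2. *)
pose rho (n : nat) := match n with 0 => rho1 | 1 => rho2 | _ => rho3 end%N.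
pose v n : rho n := match n with 0 => v1 | 1 => v2 | _ => v3 end%N.
have irr n : rep_irreducible (rho n) by case: n => [|[|]].
have := pos (fun s => rho s) (fun s => irr s) (fun s => v s).
congr (0 <= _); apply: eq_bigr => i _; congr (_ * _).
by rewrite !big_ord_recl big_ord0 mulr1 mulrA.
Qed.
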